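(* There is a quantum algorithm that, given (quantum oracle access to) a graph $G$ on $n$ vertices with maximum degree $\Delta$, properly $(\Delta+1)$-colors $G$ using $O(n^{3/2}\log n/\sqrt{\Delta})$ quantum adjacency queries in expectation.
   Context: A proper $k$-coloring of a graph $G=(V,E)$ is a map $c:V\to\{1,\dots,k\}$ with $c(u)\neq c(v)$ for every edge $\{u,v\}\in E$. A quantum adjacency query is one application of the unitary $\mathcal{O}_A$ on $\mathbb{C}^V\otimes\mathbb{C}^V$ defined by $\mathcal{O}_A|v,u\rangle=(-1)^{f_A(v,u)}|v,u\rangle$, where $f_A(v,u)=1$ if $\{v,u\}\in E$ and $0$ otherwise. The algorithm may also use classical degree queries (given $v$, return $d(v)$). The cost counted is the number of applications of $\mathcal{O}_A$; the expectation is over the algorithm's randomness (including measurement outcomes). *)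

(* Defs.v *)
From mathcomp Require Import all_boot all_order all_algebra.
From mathcomp Require Import complex.
From mathcomp Require Import all_classical all_reals all_analysis.

Set Implicit Arguments.
Unset Strict Implicit.
Unset Printing Implicit Defensive.

Import Order.TTheory GRing.Theory Num.Theory.

Local Open Scope ring_scope.
Local Open Scope complex_scope.

Record graph (n : nat) := Graph {
  adj : rel 'I_n;
  adj_sym : symmetric adj;
  adj_irrefl : irreflexive adj }.

Definition degree n (G : graph n) (v : 'I_n) : nat :=
  #|[set u | adj G v u]|.

Definition max_degree n (G : graph n) : nat :=
  (\max_(v < n) degree G v)%N.

Definition proper_coloring n (G : graph n) (k : nat)
    (c : {ffun 'I_n -> nat}) : bool :=
  [forall v, (1 <= c v <= k)%N] &&
  [forall u, forall v, adj G u v ==> (c u != c v)].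

(* Computational basis of C^V (x) C^V (x) C^W, with V = 'I_n and a finite
   work register W = 'I_m.+1. *)
Definition basis (n m : nat) : finType := ('I_n * 'I_n * 'I_m.+1)%type.

Notation state R n m := 'cV[R[i]]_#|basis n m|.
Notation operator R n m := 'M[R[i]]_#|basis n m|.

(* A quantum algorithm is the decision tree of a classical controller acting on
   a quantum register.  The graph enters only through [Degree] and [Query].
   [Random] draws a uniform element of 'I_r.+1.  [Measure f k] is the projective
   measurement whose outcome j has as its range the span of the basis states x
   with f x = j; as arbitrary unitaries can be applied before and after it,
   this covers every projective measurement.  Trees are well-founded, so every
   run halts, but run lengths may depend on outcomes and on the graph. *)
Inductive qprog (R : realType) (n m : nat) : Type :=
| Return of {ffun 'I_n -> nat}
| Degree of 'I_n & (nat -> qprog R n m)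
| Random (r : nat) of ('I_r.+1 -> qprog R n m)
| Apply (U : operator R n m) of U \is unitarymx & qprog R n m
| Query of qprog R n m
| Measure (r : nat) of (basis n m -> 'I_r) & ('I_r -> qprog R n m).

(* The input is n alone: the maximum degree is not given to the algorithm, and
   the work register may depend on n.  As usual for query complexity, the
   family over n is not required to be computable. *)
Record qalgorithm (R : realType) (n : nat) := QAlgorithm {
  work_size : nat;
  body : qprog R n work_size }.

Section Semantics.
Variables (R : realType) (n m : nat) (G : graph n).

(* O_A (x) id_W, where O_A |v,u> = (-1)^{f_A(v,u)} |v,u>. *)
Definition oracle : operator R n m :=
  diag_mx (\row_i (let: (v, u, _) := enum_val i in (-1) ^+ adj G v u)).

Definition measure_proj r (f : basis n m -> 'I_r) (j : 'I_r) :
    operator R n m :=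
  diag_mx (\row_i (f (enum_val i) == j)%:R).

Definition sqnorm (psi : state R n m) : R :=
  \sum_i (complex.Re (psi i 0) ^+ 2 + complex.Im (psi i 0) ^+ 2).

Definition normalize (psi : state R n m) : state R n m :=
  ((Num.sqrt (sqnorm psi))^-1)%:C *: psi.

(* The first computational basis state. *)
Definition init_state : state R n m := \col_i (i == 0 :> nat)%:R.

(* Expected value of g c q, where c is the output and q the total number of
   queries, when p is run from the unit vector psi with q0 queries already made.
   An outcome of probability zero contributes 0. *)
Fixpoint expect_from (g : {ffun 'I_n -> nat} -> nat -> R)
    (p : qprog R n m) (psi : state R n m) (q0 : nat) {struct p} : R :=
  match p with
  | Return c => g c q0
  | Degree v k => expect_from g (k (degree G v)) psi q0
  | @Random _ _ _ r k =>
      (r.+1%:R)^-1 * \sum_(i < r.+1) expect_from g (k i) psi q0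
  | @Apply _ _ _ U _ p' => expect_from g p' (U *m psi) q0
  | Query p' => expect_from g p' (oracle *m psi) q0.+1
  | @Measure _ _ _ r f k =>
      \sum_(j < r)
        sqnorm (measure_proj f j *m psi) *
        expect_from g (k j) (normalize (measure_proj f j *m psi)) q0
  end.

End Semantics.

Definition expectation (R : realType) n (A : qalgorithm R n) (G : graph n)
    (g : {ffun 'I_n -> nat} -> nat -> R) : R :=
  expect_from G g (body A) (init_state R n (work_size A)) 0.

Definition success_probability (R : realType) n (A : qalgorithm R n)
    (G : graph n) : R :=
  expectation A G
    (fun c _ => (proper_coloring G (max_degree G).+1 c)%:R).

Definition expected_queries (R : realType) n (A : qalgorithm R n)
    (G : graph n) : R :=
  expectation A G (fun _ q => q%:R).

(* Main.v *)
Require Import Defs.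
From mathcomp Require Import all_boot all_order all_algebra.
From mathcomp Require Import complex.
From mathcomp Require Import all_classical all_reals all_analysis.
From mathcomp Require Import ring lra zify.

(* The vertices are coloured greedily in random order; each tries uniformly random
   colours from {1, ..., Delta + 1} until one is found that no neighbour has.  A
   colour class S is tested against v by Grover iteration from the uniform
   superposition of S and v: if v has no neighbour in S the state never moves, so a
   free colour is never rejected, and otherwise a random number of at most about
   sqrt |S| iterations leaves that state with probability at least 1/4.  A
   rejection thus costs O(sqrt |S|) expected queries, and only the one acceptance
   per vertex pays the factor log n needed to make errors unlikely.

   As the colour is uniform, the average of sqrt |S| is at most sqrt (n / K), with
   K = Delta + 1.  If y + 1 colours are free for v, then v makes K / (y + 1)
   expected attempts, and its acceptance costs about log n sqrt (n / (y + 1)).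
   Among v and its neighbours the rank of v is uniform, so y is on average like a
   uniform element of {0, ..., Delta}: the expectations of K / (y + 1) and of
   sqrt (K / (y + 1)) are O(log K) and O(1), and each vertex costs
   O(log n sqrt (n / K)) queries. *)

Set Implicit Arguments.
Unset Strict Implicit.
Unset Printing Implicit Defensive.

Import Order.TTheory GRing.Theory Num.Theory.
Local Open Scope ring_scope.
Local Open Scope complex_scope.
Local Open Scope sesquilinear_scope.

(* MathComp-Analysis has constants with these names. *)
Local Notation basis := Defs.basis.
Local Notation Measure := Defs.Measure.

(** * Running programs *)

Section StateNorm.
Variables (R : realType) (n m : nat).
Local Notation vec := ('cV[R[i]]_#|basis n m|).
Implicit Type psi : vec.

Lemma sqnorm_normE psi : (sqnorm psi)%:C = \sum_i `|psi i 0| ^+ 2.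
Proof.
rewrite /sqnorm raddf_sum; apply: eq_bigr => i _; exact: add_Re2_Im2.
Qed.

Lemma sqnorm_ge0 psi : 0 <= sqnorm psi.
Proof. by apply: sumr_ge0 => i _; rewrite addr_ge0 ?sqr_ge0. Qed.

Lemma sqnormZ (z : R[i]) psi : (sqnorm (z *: psi))%:C = `|z| ^+ 2 * (sqnorm psi)%:C.
Proof.
rewrite !sqnorm_normE mulr_sumr; apply: eq_bigr => i _.
by rewrite mxE normrM exprMn.
Qed.

Lemma sqnormZ_real (x : R) psi : sqnorm (x%:C *: psi) = x ^+ 2 * sqnorm psi.
Proof.
apply: complexI; rewrite sqnormZ -add_Re2_Im2 /= -rmorphM /=.
by rewrite expr0n addr0.
Qed.

Lemma sqnorm_unitary (U : 'M[R[i]]_#|basis n m|) psi :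
  U \is unitarymx -> sqnorm (U *m psi) = sqnorm psi.
Proof.
have hermE (phi : vec) : (phi^t* *m phi) 0 0 = (sqnorm phi)%:C.
  rewrite sqnorm_normE mxE; apply: eq_bigr => i _.
  by rewrite !mxE mulrC -normCK.
move=> /unitarymxP /mulmx1C unitU; apply: complexI; rewrite -!hermE.
by rewrite trmx_mul map_mxM mulmxA -(mulmxA _ _ U) unitU mulmx1.
Qed.

Lemma sqnorm_normalize psi : sqnorm psi != 0 -> sqnorm (normalize psi) = 1.
Proof.
move=> psi0; rewrite sqnormZ_real exprVn sqr_sqrtr ?sqnorm_ge0 // mulVf //.
Qed.

Lemma sqnorm_oracle (G : graph n) psi : sqnorm (oracle R m G *m psi) = sqnorm psi.
Proof.
apply: complexI; rewrite !sqnorm_normE; apply: eq_bigr => i _.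
rewrite mul_diag_mx !mxE; case: (enum_val i) => [[v u] x].
by rewrite normrM normrX normrN normr1 expr1n mul1r.
Qed.

Lemma sqnorm_measure_proj r (f : basis n m -> 'I_r) j psi :
  (sqnorm (measure_proj R f j *m psi))%:C =
  \sum_i (f (enum_val i) == j)%:R * `|psi i 0| ^+ 2.
Proof.
rewrite sqnorm_normE; apply: eq_bigr => i _; rewrite mul_diag_mx !mxE.
by case: eqP => _; rewrite ?mul0r ?mul1r ?normr0 ?expr0n.
Qed.

Lemma sum_sqnorm_measure r (f : basis n m -> 'I_r) psi :
  \sum_j sqnorm (measure_proj R f j *m psi) = sqnorm psi.
Proof.
apply: complexI; rewrite raddf_sum sqnorm_normE.
rewrite (eq_bigr _ (fun j _ => sqnorm_measure_proj f j psi)).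
rewrite exchange_big; apply: eq_bigr => i _ /=.
rewrite -mulr_suml (bigD1 (f (enum_val i))) //= eqxx big1 ?addr0 ?mul1r //.
by move=> j /negPf; rewrite eq_sym => ->.
Qed.

Lemma sqnorm_init_state : (0 < n)%N -> sqnorm (init_state R n m) = 1.
Proof.
move=> n0; have N0 : (0 < #|basis n m|)%N.
  by rewrite !card_prod !card_ord !muln_gt0 n0.
rewrite /sqnorm (bigD1 (Ordinal N0)) //= big1 => [|i i0].
  by rewrite !mxE /=  expr1n expr0n /= !addr0.
rewrite !mxE.
have /negPf -> : (i != 0 :> nat) by [].
by rewrite /= expr0n addr0.
Qed.

(** Outcome probabilities of a run from a unit vector add up to 1. This turns a lower bound on
    success into an upper bound on failure, the form that [bounded] handles. *)
Lemma expect_from_compl (G : graph n) (g : {ffun 'I_n -> nat} -> nat -> R)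
    (p : qprog R n m) psi q : sqnorm psi = 1 ->
  expect_from G (fun c q => 1 - g c q) p psi q = 1 - expect_from G g p psi q.
Proof.
elim: p psi q => /= [c|v k IH|r k IH|U Uu p IH|p IH|r f k IH] psi q psi1.
- by [].
- exact: IH.
- under eq_bigr do rewrite IH //.
  rewrite sumrB sumr_const card_ord mulrBr mulVf //; exact: lt0r_neq0.
- by rewrite IH // sqnorm_unitary.
- by rewrite IH // sqnorm_oracle.
- rewrite -[X in _ = X - _]psi1 -(sum_sqnorm_measure f) -sumrB; apply: eq_bigr => j _.
  have [->|s0] := eqVneq (sqnorm (measure_proj R f j *m psi)) 0.
    by rewrite !mul0r subr0.
  by rewrite IH ?sqnorm_normalize // mulrBr mulr1.
Qed.

End StateNorm.

(** * Upper bounds on expectations along a program *)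

Section AffineBounds.
Variables (R : realType) (n m : nat) (G : graph n) (w : R).
Variable h : {ffun 'I_n -> nat} -> R.
Hypothesis w0 : 0 <= w.
Local Notation vec := ('cV[R[i]]_#|basis n m|).
Local Notation prog := (qprog R n m).

(* With [w = 1], [h = 0] this bounds the expected number of further queries, and
   with [w = 0] and [h] the indicator of failure, the failure probability. *)
Definition bounded_at (p : prog) (psi : vec) (B : R) : Prop :=
  forall q, expect_from G (fun c q => w * q%:R + h c) p psi q <= w * q%:R + B.

(** Each search starts by resetting the register, so bounds can be uniform over unit vectors and no
    state has to be tracked from one stage to the next. *)
Definition bounded (p : prog) (B : R) : Prop :=
  forall psi, sqnorm psi = 1 -> bounded_at p psi B.

Lemma bounded_at_le p psi B B' : bounded_at p psi B -> B <= B' -> bounded_at p psi B'.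
Proof. by move=> b le q; apply: le_trans (b q) _; rewrite lerD2l. Qed.

Lemma bounded_le p B B' : bounded p B -> B <= B' -> bounded p B'.
Proof. by move=> b le psi psi1; apply: bounded_at_le (b _ psi1) le. Qed.

Lemma bounded_return c B : h c <= B -> bounded (Return R m c) B.
Proof. by move=> hB psi _ q /=; rewrite lerD2l. Qed.

Lemma bounded_at_random r (k : 'I_r.+1 -> prog) psi B :
  (forall i, bounded_at (k i) psi (B i)) ->
  bounded_at (Random k) psi (r.+1%:R^-1 * \sum_i B i).
Proof.
move=> b q /=.
have -> : w * q%:R = r.+1%:R^-1 * \sum_(i < r.+1) (w * q%:R).
  rewrite sumr_const card_ord -[(w * _) *+ _]mulr_natl mulKf //; exact: lt0r_neq0.
rewrite -mulrDr ler_wpM2l ?invr_ge0 // -big_split; apply: ler_sum => i _; exact: b.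
Qed.

Lemma bounded_random r (k : 'I_r.+1 -> prog) B :
  (forall i, bounded (k i) (B i)) -> bounded (Random k) (r.+1%:R^-1 * \sum_i B i).
Proof. by move=> b psi psi1; apply: bounded_at_random => i; apply: b. Qed.

Lemma bounded_at_apply U Uu p psi B :
  bounded_at p (U *m psi) B -> bounded_at (@Apply R n m U Uu p) psi B.
Proof. by []. Qed.

Lemma bounded_at_query p psi B :
  bounded_at p (oracle R m G *m psi) B -> bounded_at (Query p) psi (w + B).
Proof.
move=> b q /=; apply: le_trans (b _) _.
by rewrite -natr1 mulrDr mulr1 addrA.
Qed.

Lemma bounded_at_measure r (f : basis n m -> 'I_r) k psi B :
  sqnorm psi = 1 ->
  (forall j, let phi := measure_proj R f j *m psi in
     sqnorm phi != 0 -> bounded_at (k j) (normalize phi) (B j)) ->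
  bounded_at (Measure f k) psi (\sum_j sqnorm (measure_proj R f j *m psi) * B j).
Proof.
move=> psi1 b q /=.
have -> : w * q%:R = \sum_j sqnorm (measure_proj R f j *m psi) * (w * q%:R).
  by rewrite -mulr_suml sum_sqnorm_measure psi1 mul1r.
rewrite -big_split.
apply: ler_sum => j _ /=.
have [->|s0] := eqVneq (sqnorm (measure_proj R f j *m psi)) 0.
  by rewrite !mul0r addr0.
rewrite -mulrDr ler_wpM2l ?sqnorm_ge0 //; exact: b.
Qed.

Lemma bounded_at_measure_const r (f : basis n m -> 'I_r) k psi B :
  sqnorm psi = 1 ->
  (forall j, let phi := measure_proj R f j *m psi in
     sqnorm phi != 0 -> bounded_at (k j) (normalize phi) B) ->
  bounded_at (Measure f k) psi B.
Proof.
move=> psi1 b; have := bounded_at_measure psi1 b.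
by rewrite -mulr_suml sum_sqnorm_measure psi1 mul1r.
Qed.

End AffineBounds.

(** * Grover iteration *)

Section Reflection.
Variables (R : realType) (N : nat).
Implicit Types u v x : 'cV[R]_N.

Definition dot u v : R := (u^T *m v) 0 0.

Lemma dotE u v : dot u v = \sum_i u i 0 * v i 0.
Proof. by rewrite /dot mxE; apply: eq_bigr => i _; rewrite mxE. Qed.

Lemma dotC u v : dot u v = dot v u.
Proof. by rewrite !dotE; apply: eq_bigr => i _; rewrite mulrC. Qed.

Lemma dotDr u v x : dot u (v + x) = dot u v + dot u x.
Proof. by rewrite /dot mulmxDr mxE. Qed.

Lemma dotZr a u v : dot u (a *: v) = a * dot u v.
Proof. by rewrite /dot -scalemxAr mxE. Qed.

Lemma dotBr u v x : dot u (v - x) = dot u v - dot u x.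
Proof. by rewrite /dot mulmxBr !mxE. Qed.

Lemma dotDl u v x : dot (u + v) x = dot u x + dot v x.
Proof. by rewrite !(dotC _ x) dotDr. Qed.

Lemma dot_delta i v : dot (delta_mx i 0) v = v i 0.
Proof.
rewrite dotE (bigD1 i) //= big1 ?addr0 ?mxE ?eqxx ?mul1r // => j ji.
by rewrite mxE (negPf ji) mul0r.
Qed.

(* For [u = 0] this is [- 1], as [2 / 0 = 0]; so it is always orthogonal. *)
Definition refl u : 'M[R]_N := (2 / dot u u) *: (u *m u^T) - 1%:M.

Lemma refl_mul u x : refl u *m x = (2 / dot u u * dot u x) *: u - x.
Proof.
rewrite /refl mulmxBl mul1mx -scalemxAl -mulmxA [u^T *m x]mx11_scalar.
by rewrite mul_mx_scalar scalerA.
Qed.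

Lemma tr_refl u : (refl u)^T = refl u.
Proof. by rewrite /refl linearB linearZ /= trmx_mul trmxK trmx1. Qed.

Lemma refl_sqr u : refl u *m refl u = 1%:M.
Proof.
rewrite {1}/refl mulmxBl mul1mx -scalemxAl -mulmxA.
have -> : u^T *m refl u = (2 / dot u u * dot u u - 1) *: u^T.
  apply: trmx_inj; rewrite trmx_mul trmxK tr_refl refl_mul linearZ /= trmxK.
  by rewrite scalerBl scale1r.
rewrite -scalemxAr scalerA /refl opprB addrCA -scalerBl.
have [->|u0] := eqVneq (dot u u) 0; first by rewrite invr0 !mulr0 mul0r subrr scale0r
  addr0.
by rewrite divfK // [_ * (2 - 1)]mulrC (_ : 2 - 1 = 1) ?mul1r ?subrr ?scale0r ?addr0
  //; ring.
Qed.

Lemma dot_refl u x v : dot (refl u *m x) (refl u *m v) = dot x v.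
Proof. by rewrite /dot trmx_mul tr_refl -mulmxA (mulmxA (refl u)) refl_sqr mul1mx.
  Qed.

Lemma refl_unitary u : map_mx (real_complex R) (refl u) \is unitarymx.
Proof.
apply/unitarymxP; set U := map_mx _ _.
have -> : U^t* = U.
  apply/matrixP => i j; rewrite mxE mxE mxE [RHS]mxE -[in RHS](tr_refl u) [in RHS]mxE.
  exact: conjc_real.
by rewrite -map_mxM refl_sqr map_mx1.
Qed.

Lemma dot_swap u i : dot u u = 1 -> 0 <= u i 0 ->
  let e := delta_mx i 0 in dot (e + u) (e + u) = 2 * (1 + u i 0) /\ 1 + u i 0 != 0.
Proof.
move=> uu ui e; split; last by rewrite lt0r_neq0 // ltr_wpDr.
rewrite dotDl !dotDr uu !dot_delta (dotC u) dot_delta !mxE !eqxx /=; ring.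
Qed.

(** The reflection in the bisector of two unit vectors exchanges them; the sign condition keeps
    their sum nonzero. This prepares [u] from a basis state. *)
Lemma refl_swap u i : dot u u = 1 -> 0 <= u i 0 ->
  refl (delta_mx i 0 + u) *m delta_mx i 0 = u.
Proof.
move=> uu ui; have [d2 d0] := dot_swap uu ui; rewrite refl_mul d2 dotC.
rewrite dotDr !dot_delta !mxE !eqxx /=.
rewrite (_ : 2 / _ * _ = 1) ?scale1r; last by field.
by rewrite addrC addrA addNr add0r.
Qed.

(** The reflection is symmetric and takes basis vector [i] to [u], so reading [i] after it measures
    the overlap with [u]. *)
Lemma refl_swap_entry u i x : dot u u = 1 -> 0 <= u i 0 ->
  (refl (delta_mx i 0 + u) *m x) i 0 = dot u x.
Proof.
move=> uu ui; have [d2 d0] := dot_swap uu ui; rewrite refl_mul d2 dotDl.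
by rewrite dot_delta !mxE !eqxx /=; field.
Qed.

(* [refl s *m O] rotates the plane of [s] and [O *m s] by [phi]. *)
Lemma iter_refl_cos (O : 'M[R]_N) (s : 'cV[R]_N) phi j :
  O *m O = 1%:M -> dot s s = 1 -> dot s (O *m s) = cos phi -> sin phi != 0 ->
  dot s (iter j (mulmx (refl s *m O)) s) = cos (phi *+ j).
Proof.
move=> OO ss sOs sphi.
(* Up to sign, the coefficients are Chebyshev polynomials of the second kind in [cos phi]; the
   induction step is their three-term recurrence. *)
suff -> : iter j (mulmx (refl s *m O)) s =
    (sin (phi *+ j.+1) / sin phi) *: s - (sin (phi *+ j) / sin phi) *: (O *m s).
  rewrite dotBr !dotZr ss sOs mulrS sinD; field=> //.
elim: j => [|j IH] /=.
  by rewrite ?mulr1n ?mulr0n sin0 mul0r scale0r subr0 divff // scale1r.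
rewrite IH mulmxBr -!scalemxAr -!mulmxA (mulmxA O O) OO mul1mx !refl_mul ss sOs.
rewrite [sin (phi *+ j.+2)](_ : _ = 2 * cos phi * sin (phi *+ j.+1) - sin (phi *+ j)).
  set a := sin _; set b := sin _; apply/matrixP => i k; rewrite !mxE; field=> //.
rewrite !(mulrS phi) !sinD !cosD.
ring: (sin2cos2 phi).
Qed.

End Reflection.

(** By the double angle formula the sum is M / 2 plus half a sum of cosines, which telescopes after
    multiplication by [2 * sin phi] and is at most M / 2 by the second hypothesis. *)
Lemma sum_cos_sqr_le (R : realType) (phi : R) (M : nat) :
  0 < sin phi -> 1 <= M%:R * sin phi ->
  \sum_(j < M) cos (phi *+ j.+1) ^+ 2 <= 3 / 4 * M%:R.
Proof.
move=> s0 Ms.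
have tele : 2 * sin phi * (2 * (\sum_(j < M) cos (phi *+ j.+1) ^+ 2) - M%:R) =
    sin (phi *+ (2 * M).+1) - sin phi.
  elim: M {Ms} => [|M IH].
    by rewrite big_ord0 mulr0 subr0 mulr0 muln0 mulr1n subrr.
  rewrite big_ord_recr /=; set S := \sum_(_ < M) _ in IH *.
  rewrite (_ : 2 * sin phi * _ = 2 * sin phi * (2 * S - M%:R) +
    2 * sin phi * (2 * cos (phi *+ M.+1) ^+ 2 - 1)); last by rewrite -natr1; ring.
  rewrite {}IH !mul2n -!addnn addSn addnS !(mulrS phi) mulrnDr !(sinD, cosD).
  ring: (sin2cos2 phi) (sin2cos2 (phi *+ M)).
have := sin_le1 (phi *+ (2 * M).+1); nra.
Qed.

Section RealStates.
Variables (R : realType) (n m : nat) (G : graph n) (w : R).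
Variable h : {ffun 'I_n -> nat} -> R.
Hypothesis w0 : 0 <= w.
Local Notation N := #|basis n m|.
Local Notation prog := (qprog R n m).
Local Notation bounded_at := (bounded_at G w h).
Local Notation bounded := (bounded G w h).

Definition embed (t : 'cV[R]_N) : 'cV[R[i]]_N := map_mx (real_complex R) t.

Definition real_oracle : 'M[R]_N :=
  diag_mx (\row_i (let: (v, u, _) := enum_val i in (-1) ^+ adj G v u)).

Lemma oracle_embed t : oracle R m G *m embed t = embed (real_oracle *m t).
Proof.
apply/matrixP => i j; rewrite !mul_diag_mx !mxE; case: (enum_val i) => [[v u] x].
by rewrite rmorphM rmorphXn rmorphN rmorph1.
Qed.

Lemma real_oracle_sqr : real_oracle *m real_oracle = 1%:M.
Proof.
apply/matrixP => i j; rewrite mul_diag_mx !mxE; case: (enum_val i) => [[v u] x].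
by rewrite mulrnAr -expr2 sqrr_sign.
Qed.

Lemma sqnorm_embed t : sqnorm (embed t) = dot t t.
Proof.
rewrite dotE; apply: eq_bigr => i _; rewrite !mxE /=.
by rewrite expr0n addr0 expr2.
Qed.

Lemma sqnorm_phase (z : R[i]) t : `|z| = 1 -> sqnorm (z *: embed t) = dot t t.
Proof.
by move=> z1; apply: complexI; rewrite sqnormZ z1 expr1n mul1r sqnorm_embed.
Qed.

Definition reflect_by (u : 'cV[R]_N) (p : prog) : prog :=
  Apply (refl_unitary u) p.

Lemma bounded_at_reflect u p z t B :
  bounded_at p (z *: embed (refl u *m t)) B ->
  bounded_at (reflect_by u p) (z *: embed t) B.
Proof.
by move=> b; apply: bounded_at_apply; rewrite -scalemxAr -map_mxM.
Qed.

Definition grover_step (s : 'cV[R]_N) (p : prog) : prog := Query (reflect_by s p).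

Lemma bounded_at_grover s p j z t B :
  bounded_at p (z *: embed (iter j (mulmx (refl s *m real_oracle)) t)) B ->
  bounded_at (iter j (grover_step s) p) (z *: embed t) (w *+ j + B).
Proof.
elim: j t => [|j IH] t b; first by rewrite mulr0n add0r.
rewrite mulrS -addrA; apply: bounded_at_query; rewrite -scalemxAr oracle_embed.
by apply: bounded_at_reflect; apply: IH; rewrite mulmxA -iterSr.
Qed.

(** A complete measurement resets any state to a basis vector, up to a phase: [normalize] divides by
    a real norm only. *)
Lemma bounded_at_basis_measure (k : 'I_N -> prog) psi B :
  sqnorm psi = 1 ->
  (forall i (z : R[i]), `|z| = 1 -> bounded_at (k i) (z *: embed (delta_mx i 0)) B) ->
  bounded_at (Measure (fun x => enum_rank x) k) psi B.
Proof.
move=> psi1 b; apply: bounded_at_measure_const => // i /=.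
set phi := _ *m _ => phi0.
have phiE : phi = psi i 0 *: embed (delta_mx i 0).
  apply/matrixP => l o; rewrite /phi mul_diag_mx !mxE enum_valK (ord1 o) eqxx andbT.
  by case: eqP => [->|_]; rewrite ?mul1r ?mulr1 ?mul0r ?mulr0.
rewrite /normalize {2}phiE scalerA; apply: b.
have nphi : (sqnorm phi)%:C = `|psi i 0| ^+ 2.
  by rewrite phiE sqnormZ sqnorm_embed dot_delta mxE !eqxx mulr1.
have : `|((Num.sqrt (sqnorm phi))^-1)%:C * psi i 0| ^+ 2 = 1.
  rewrite normrM exprMn -nphi -add_Re2_Im2 /= expr0n addr0 -rmorphM /=.
  by rewrite exprVn sqr_sqrtr ?sqnorm_ge0 // mulVf.
by move/eqP; rewrite sqrp_eq1 ?normr_ge0 // => /eqP.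
Qed.

Definition measure_at (i : 'I_N) (k : bool -> prog) : prog :=
  Measure (fun x => if enum_rank x == i then ord0 else lift ord0 ord0 : 'I_2)
    (fun o => k (o == ord0)).

Lemma bounded_at_measure_at i k (z : R[i]) t B1 B0 : `|z| = 1 -> dot t t = 1 ->
  bounded (k true) B1 -> bounded (k false) B0 ->
  bounded_at (measure_at i k) (z *: embed t) (t i 0 ^+ 2 * B1 + (1 - t i 0 ^+ 2) *
    B0).
Proof.
move=> z1 t1 b1 b0; set psi := z *: _.
have psi1 : sqnorm psi = 1 by rewrite sqnorm_phase.
pose f := fun x : basis n m => if enum_rank x == i then ord0 else lift ord0 ord0 :
  'I_2.
have n0 : sqnorm (measure_proj R f ord0 *m psi) = t i 0 ^+ 2.
  apply: complexI; rewrite sqnorm_measure_proj (bigD1 i) //= big1 => [|l li].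
    rewrite /f enum_valK !eqxx mul1r addr0 !mxE normrM z1 mul1r.
    by rewrite -add_Re2_Im2 /= expr0n addr0.
  by rewrite /f enum_valK (negPf li) mul0r.
have n1 : sqnorm (measure_proj R f (lift ord0 ord0) *m psi) = 1 - t i 0 ^+ 2.
  by apply/eqP; rewrite eq_sym subr_eq addrC -n0 -psi1 -(sum_sqnorm_measure f)
    big_ord_recl big_ord1.
have := @bounded_at_measure _ _ _ G w h _ f (fun o => k (o == ord0)) psi
  (fun o => if o == ord0 then B1 else B0) psi1.
rewrite big_ord_recl big_ord1 n0 n1 /=; apply=> j phi phi0.
by case: eqP => _; [apply: b1 | apply: b0]; exact: sqnorm_normalize.
Qed.

(* A decision version of Grover search: if no vertex is marked the register
   stays in state [s], so reading anything else is a proof of a marked vertex. *)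
Definition detect_once (s : 'cV[R]_N) (r : nat) (k : bool -> prog) : prog :=
  Measure (fun x => enum_rank x) (fun i =>
    reflect_by (delta_mx i 0 + s) (Random (fun j : 'I_r.+1 =>
      iter j.+1 (grover_step s)
        (reflect_by (delta_mx i 0 + s) (measure_at i (fun b => k (~~ b))))))).

(** Its square is the chance that [detect_once] finds the register still in [s] after [j] steps and
    so has no evidence. *)
Definition overlap (s : 'cV[R]_N) j := dot s (iter j (mulmx (refl s *m real_oracle))
  s).

Lemma dot_oracle (t t' : 'cV[R]_N) : dot (real_oracle *m t) (real_oracle *m t') = dot
  t t'.
Proof.
by rewrite /dot trmx_mul tr_diag_mx -mulmxA (mulmxA real_oracle) real_oracle_sqr
  mul1mx.
Qed.

Lemma bounded_detect_once s r k B1 B0 : dot s s = 1 -> (forall i, 0 <= s i 0) ->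
  bounded (k true) B1 -> bounded (k false) B0 ->
  bounded (detect_once s r k) (w * r.+1%:R + r.+1%:R^-1 *
    \sum_(j < r.+1) (overlap s j.+1 ^+ 2 * B0 + (1 - overlap s j.+1 ^+ 2) * B1)).
Proof.
move=> ss s0 b1 b0 psi psi1; apply: bounded_at_basis_measure => // i z z1.
apply: bounded_at_reflect; rewrite refl_swap //.
have iter1 j : dot (iter j (mulmx (refl s *m real_oracle)) s)
                   (iter j (mulmx (refl s *m real_oracle)) s) = 1.
  by elim: j => [|j IH] //=; rewrite -!mulmxA dot_refl dot_oracle.
pose F (j : 'I_r.+1) := overlap s j.+1 ^+ 2 * B0 + (1 - overlap s j.+1 ^+ 2) * B1.
apply: (@bounded_at_le _ _ _ _ _ _ _ _ (r.+1%:R^-1 * \sum_(j < r.+1) (w *+ j.+1 + F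
  j))).
  apply: bounded_at_random => j; apply: bounded_at_grover.
  apply: bounded_at_reflect.
  rewrite /F /overlap -(refl_swap_entry _ ss (s0 i));
    apply: bounded_at_measure_at => //.
  by rewrite dot_refl.
(* Each of the equally likely step counts is charged as the largest, [r.+1]. *)
rewrite big_split mulrDr lerD2r ler_pdivrMl ?ltr0Sn //
  mulr_natl -[X in _ *+ X]card_ord.
rewrite -sumr_const; apply: ler_sum => j _; rewrite -[leLHS]mulr_natr.
by rewrite ler_wpM2l // ler_nat ltn_ord.
Qed.

End RealStates.

(** * Searching a colour class *)

Section Search.
Variables (R : realType) (n m : nat) (G : graph n) (w : R).
Variable h : {ffun 'I_n -> nat} -> R.
Hypothesis w0 : 0 <= w.
Local Notation N := #|basis n m|.
Local Notation prog := (qprog R n m).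
Local Notation bounded := (bounded G w h).
Implicit Types (v : 'I_n) (A S : {set 'I_n}).

(** With the first register held at [v], the oracle gives the component of [u] the sign that tells
    whether [u] is a neighbour of [v]. *)
Definition row_block v A (x : basis n m) : bool :=
  [&& x.1.1 == v, x.1.2 \in A & x.2 == ord0].

Definition uniform v A : 'cV[R]_N :=
  (Num.sqrt #|A|%:R)^-1 *: \col_i (row_block v A (enum_val i))%:R.

Lemma uniform_ge0 v A i : 0 <= uniform v A i 0.
Proof. by rewrite !mxE mulr_ge0 // invr_ge0 sqrtr_ge0. Qed.

Lemma sum_uniform_sqr v A (F : 'I_n -> R) :
  \sum_i uniform v A i 0 ^+ 2 * F (enum_val i).1.2 = #|A|%:R^-1 * \sum_(u in A) F u.
Proof.
have -> : \sum_i uniform v A i 0 ^+ 2 * F (enum_val i).1.2 = #|A|%:R^-1 *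
    \sum_(i < N) (if row_block v A (enum_val i)
                  then F (enum_val i).1.2 else 0).
  rewrite mulr_sumr; apply: eq_bigr => i _; rewrite !mxE exprMn exprVn sqr_sqrtr //.
  by case: ifP => _; rewrite ?expr1n ?mulr1 // expr0n !(mulr0, mul0r).
congr (_ * _).
rewrite -(big_enum_val (fun x : basis n m => if row_block v A x then F x.1.2 else 0)).
rewrite -big_mkcondr /= (reindex_onto (fun u => (v, u, ord0)) (fun x => x.1.2)) /=.
  by apply: eq_bigl => u; rewrite /row_block /= !eqxx !andbT.
by case=> [[v' u] x]; rewrite /row_block /= => /and3P[/eqP-> _ /eqP->].
Qed.

Lemma dot_uniform v A : (0 < #|A|)%N -> dot (uniform v A) (uniform v A) = 1.
Proof.
move=> A0; rewrite dotE.
have := sum_uniform_sqr v A (fun=> 1); under eq_bigr do rewrite mulr1 expr2.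
by move=> ->; rewrite sumr_const mulVf // pnatr_eq0 -lt0n.
Qed.

Lemma oracle_uniform v A i :
  (real_oracle R m G *m uniform v A) i 0 =
  (-1) ^+ adj G v (enum_val i).1.2 * uniform v A i 0.
Proof.
rewrite mul_diag_mx !mxE; case: (enum_val i) => [[v' u] x] /=.
by rewrite /row_block /=; case: eqP => [->//|_]; rewrite !mulr0.
Qed.

(** Unmarked weight minus marked weight; this is the cosine of the Grover rotation angle. *)
Lemma dot_uniform_oracle v A : (0 < #|A|)%N ->
  dot (uniform v A) (real_oracle R m G *m uniform v A) =
  1 - 2 * #|[set u in A | adj G v u]|%:R / #|A|%:R.
Proof.
move=> A0; rewrite dotE.
have := sum_uniform_sqr v A (fun u => (-1) ^+ adj G v u).
under eq_bigr do rewrite mulrC expr2 mulrA -oracle_uniform mulrC.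
move=> ->.
have -> : \sum_(u in A) (-1) ^+ adj G v u = #|A|%:R - 2 * #|[set u in A | adj G v
  u]|%:R :> R.
  rewrite -!sumr_const.
  rewrite (big_mkcond (fun u => u \in [set _ in _ | _])) /= (big_mkcond (mem A)) [in
    RHS](big_mkcond (mem A)) /=.
  rewrite mulr_sumr -sumrB; apply: eq_bigr => u _; rewrite inE.
  by case: (u \in A); case: (adj G v u) => /=; rewrite ?expr0 ?expr1; ring.
have : #|A|%:R != 0 :> R by rewrite pnatr_eq0 -lt0n.
by move=> ?; field.
Qed.

Lemma overlap_unmarked v A j : (0 < #|A|)%N -> (forall u, u \in A -> ~~ adj G v u) ->
  overlap G (uniform v A) j = 1.
Proof.
move=> A0 free; have Os : real_oracle R m G *m uniform v A = uniform v A.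
  apply/matrixP => i o; rewrite (ord1 o) oracle_uniform.
  rewrite !mxE; case: (enum_val i) => [[v' u] x] /=; rewrite /row_block /=.
  have [/free/negPf->|_] := boolP (u \in A); first by rewrite expr0 mul1r.
  by rewrite andbF !mulr0.
rewrite /overlap; suff -> : iter j (mulmx (refl (uniform v A) *m real_oracle R m G))
  (uniform v A) = uniform v A.
  exact: dot_uniform.
elim: j => //= j ->; rewrite -mulmxA Os refl_mul dot_uniform // divr1 mulr1.
by rewrite scaler_nat mulr2n addrK.
Qed.

(** As [v] is not its own neighbour, adding it guarantees an unmarked element even if all of [S] is
    marked. The angle then stays away from pi, and its sine times [r.+1] is at least 1, as
    [sum_cos_sqr_le] requires. *)
Lemma sum_overlap_marked v S (r := Num.truncn (Num.sqrt #|S|%:R : R)) :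
  v \notin S -> (exists2 u, u \in S & adj G v u) ->
  \sum_(j < r.+1) overlap G (uniform v (v |: S)) j.+1 ^+ 2 <= 3 / 4 * r.+1%:R.
Proof.
move=> vS [u0 u0S vu0].
have A0 : (0 < #|v |: S|)%N by rewrite cardsU1 vS.
set s := uniform _ _.
pose k := #|[set u in v |: S | adj G v u]|.
have k1 : (1 <= k)%N by rewrite card_gt0; apply/set0Pn; exists u0;
  rewrite !inE u0S vu0 orbT.
have kS : (k <= #|S|)%N.
  apply: subset_leq_card; apply/fintype.subsetP => u; rewrite !inE.
  by case: eqP => [->|_]; [rewrite adj_irrefl andbF | case/andP].
have AE : #|v |: S|%:R = #|S|%:R + 1 :> R by rewrite cardsU1 vS natrD addrC.
pose y := dot s (real_oracle R m G *m s).
have yE : y = 1 - 2 * k%:R / (#|S|%:R + 1) by rewrite /y dot_uniform_oracle // AE.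
have k1' : 1 <= k%:R :> R by rewrite ler1n.
have kS' : k%:R <= #|S|%:R :> R by rewrite ler_nat.
have S1 : 0 < #|S|%:R + 1 :> R by lra.
pose p := k%:R / (#|S|%:R + 1) : R.
have pE : p * (#|S|%:R + 1) = k%:R by rewrite divfK // lt0r_neq0.
have yp : y = 1 - 2 * p by rewrite yE mulrA.
have p0 : 0 <= p by rewrite divr_ge0 //; lra.
have p1 : p <= 1 by rewrite ler_pdivrMr //; lra.
have y1 : -1 <= y <= 1 by rewrite yp; apply/andP; split; lra.
have cphi : cos (acos y) = y by rewrite acosK // in_itv.
have r1 : Num.sqrt #|S|%:R <= r.+1%:R :> R by apply/ltW/truncnS_gt.
have r0 : 0 <= r.+1%:R :> R by [].
have : 1 <= (r.+1%:R * sin (acos y)) ^+ 2.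
  rewrite exprMn sin2cos2 cphi yp.
  have r2 : #|S|%:R <= r.+1%:R ^+ 2 :> R.
    by rewrite -[leLHS]sqr_sqrtr // lerXn2r ?nnegrE ?sqrtr_ge0.
  have -> : 1 - (1 - 2 * p) ^+ 2 = 4 * p * (1 - p) by ring.
  (* For k between 1 and |S| the concave k (|S| + 1 - k) is least at the ends, where it equals
     |S|. *)
  have pp : #|S|%:R <= p * (1 - p) * (#|S|%:R + 1) ^+ 2.
    have -> : p * (1 - p) * (#|S|%:R + 1) ^+ 2 = k%:R * (#|S|%:R + 1 - k%:R).
      by rewrite -pE; ring.
    nra.
  move: (#|S|%:R : R) (k%:R : R) (r.+1%:R ^+ 2 : R) k1' kS' S1 r2 pp =>
    S' k' r' k1' kS' S1 r2 pp.
  have q : 0 < (S' + 1) ^+ 2 by rewrite exprn_gt0.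
  rewrite -(ler_pM2r q) mul1r.
  apply: (@le_trans _ _ (S' * (4 * S'))); first nra.
  by rewrite -[leRHS]mulrA; apply: ler_pM => //; lra.
have sin0 : 0 <= sin (acos y).
  by apply: sin_ge0_pi; rewrite acos_ge0 ?acos_lepi.
rewrite expr_ge1 ?mulr_ge0 // => rs.
have spos : 0 < sin (acos y).
  by rewrite lt0r sin0 andbT; apply/eqP => e; move: rs; rewrite e mulr0 ler10.
under eq_bigr => j _ do rewrite /overlap (@iter_refl_cos _ _ _ _ (acos y))
  ?real_oracle_sqr ?dot_uniform ?(lt0r_neq0 spos) //.
exact: sum_cos_sqr_le.
Qed.

Definition rounds S := (Num.truncn (Num.sqrt #|S|%:R : R)).+1.

(** The error is one-sided: [true] needs evidence of a neighbour, whereas [false] only means [L]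
    runs without evidence. *)
Fixpoint search v S (L : nat) (k : bool -> prog) : prog :=
  if L is L'.+1 then
    detect_once (uniform v (v |: S)) (rounds S).-1
      (fun b => if b then k true else search v S L' k)
  else k false.

Lemma bounded_search_unmarked v S L k B1 B0 :
  (forall u, u \in S -> ~~ adj G v u) ->
  bounded (k true) B1 -> bounded (k false) B0 ->
  bounded (search v S L k) (L%:R * (w * (rounds S)%:R) + B0).
Proof.
move=> free b1 b0; elim: L => [|L IH] /=; first by rewrite mul0r add0r.
have A0 : (0 < #|v |: S|)%N by apply/card_gt0P; exists v; rewrite !inE eqxx.
apply: bounded_le (@bounded_detect_once _ _ _ G w h w0 (uniform v (v |: S))
  (rounds S).-1 (fun b => if b then k true else search v S L k) _ _
  (dot_uniform _ A0) (uniform_ge0 _ _) b1 IH) _.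
have freeA u : u \in v |: S -> ~~ adj G v u.
  by rewrite !inE => /orP[/eqP->|/free//]; rewrite adj_irrefl.
under eq_bigr do rewrite (overlap_unmarked _ A0 freeA) expr1n mul1r subrr mul0r addr0.
rewrite sumr_const card_ord -[X in _^-1 * X]mulr_natl mulKf ?lt0r_neq0 // /rounds /=.
rewrite -[L.+1%:R]natr1; lra.
Qed.

(** Each run finds evidence with chance at least 1/4, so 4 runs are expected however large [L] is;
    all [L] runs miss with chance at most (3/4)^L, at the surcharge [D]. *)
Lemma bounded_search_marked v S L k B1 B0 D :
  v \notin S -> (exists2 u, u \in S & adj G v u) -> 0 <= D -> B0 <= B1 + D ->
  bounded (k true) B1 -> bounded (k false) B0 ->
  bounded (search v S L k) (4 * (w * (rounds S)%:R) + B1 + (3 / 4) ^+ L * D).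
Proof.
move=> vS marked D0 B01 b1 b0; have wr0 : 0 <= w * (rounds S)%:R by rewrite mulr_ge0.
elim: L => [|L IH] /=.
  apply: bounded_le b0 _; rewrite expr0 mul1r; lra.
have A0 : (0 < #|v |: S|)%N by apply/card_gt0P; exists v; rewrite !inE eqxx.
apply: bounded_le (@bounded_detect_once _ _ _ G w h w0 (uniform v (v |: S))
  (rounds S).-1 (fun b => if b then k true else search v S L k) _ _
  (dot_uniform _ A0) (uniform_ge0 _ _) b1 IH) _.
set C := _ + _ * D; have /= := sum_overlap_marked vS marked.
rewrite -/(rounds S) /=; set T := \sum_(j < _) _ => Tle.
have -> : \sum_(j < (rounds S).-1.+1) (overlap G (uniform v (v |: S)) j.+1 ^+ 2 * C +
    (1 - overlap G (uniform v (v |: S)) j.+1 ^+ 2) * B1) = T * (C - B1) + (rounds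
      S)%:R * B1.
  rewrite mulr_suml [in RHS]mulr_natl -[X in _ *+ X]card_ord -sumr_const -big_split.
  by apply: eq_bigr => j _ /=; ring.
have rpos : 0 < (rounds S)%:R :> R by rewrite ltr0n.
have CB : 0 <= C - B1.
  rewrite /C; have : 0 <= (3 / 4) ^+ L * D by rewrite mulr_ge0 // exprn_ge0 //; lra.
  lra.
rewrite mulrDr mulKf ?lt0r_neq0 //.
(* One run, then the remaining ones with chance at most 3/4: 1 + 3/4 * 4 = 4. *)
have : (rounds S)%:R^-1 * (T * (C - B1)) <= 3 / 4 * (C - B1).
  by rewrite ler_pdivrMl // mulrA ler_wpM2r // mulrC.
move: (_^-1 * (T * _)) => X; rewrite /C exprS -[_ * _ * D]mulrA;
  move: (_ ^+ L * D) => e; rewrite /rounds /=; lra.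
Qed.

End Search.

(** * Trying colours *)

(* Colour [0] marks the vertices that are not yet coloured. *)
Section PartialColorings.
Variables (n : nat) (G : graph n) (D : nat).
Hypothesis degD : forall v, (degree G v <= D)%N.
Implicit Types (c : {ffun 'I_n -> nat}) (U : {set 'I_n}).

Definition color_class c j : {set 'I_n} := [set u | c u == j].

Definition recolor c v j : {ffun 'I_n -> nat} := [ffun u =>
  if u == v then j else c u].

Definition free_color c v (i : 'I_D.+1) : bool :=
  [forall u in color_class c i.+1, ~~ adj G v u].

(* At least [slack + 1] colours are free for [v] if [U] is the uncoloured set. *)
Definition slack U v : nat := D - degree G v + #|[set u in U | adj G v u]|.

(** Adjacent uncoloured vertices share the value 0, so only nonzero values must differ. *)
Definition partial_proper c : Prop :=
  (forall u, (c u <= D.+1)%N) /\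
  (forall u v, adj G u v -> c u != 0%N -> c u != c v).

(** Every blocked colour is that of a coloured neighbour, and there are [degree G v] minus the
    uncoloured ones of these. The colouring need not be proper so far. *)
Lemma slack_card_free c v :
  (slack (color_class c 0) v < #|[set i | free_color c v i]|)%N.
Proof.
set F := [set i | _].
have sub : ~: F \subset
    [set inord (c u).-1 | u in [set u | adj G v u] :\: [set u in color_class c 0 |
      adj G v u]].
  apply/fintype.subsetP => i; rewrite !inE negb_forall => /existsP[u].
  rewrite negb_imply negbK inE => /andP[/eqP cu vu]; apply/imsetP; exists u.
    by rewrite !inE vu cu.
  by rewrite cu /= inord_val.
have := leq_trans (subset_leq_card sub) (leq_imset_card _ _).
have XN : [set u in color_class c 0 | adj G v u] \subset [set u | adj G v u].
  by apply/fintype.subsetP => u; rewrite !inE => /andP[].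
rewrite cardsD (finset.setIidPr XN) -/(degree G v).
have := subset_leq_card XN; rewrite -/(degree G v).
have := cardsC F; have := degD v; rewrite card_ord /slack.
have arith a b d x : (d <= D -> a + b = D.+1 -> x <= d -> b <= d - x ->
  D - d + x < a)%N.
  by clear; lia.
exact: arith.
Qed.

Lemma color_class_recolor0 c v j : c v = 0%N ->
  color_class (recolor c v j.+1) 0 = color_class c 0 :\ v.
Proof. by move=> cv; apply/setP => u; rewrite !inE ffunE; case: (u == v). Qed.

Lemma partial_proper_recolor c v i : c v = 0%N -> free_color c v i ->
  partial_proper c -> partial_proper (recolor c v i.+1).
Proof.
move=> cv /forall_inP fi [cD cp]; split=> [u|u u' uu'].
  by rewrite ffunE; case: (u =P v) => [_|_]; [exact: ltn_ord | exact: cD].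
rewrite !ffunE; case: (u =P v) => [uv|_]; case: (u' =P v) => [u'v|_].
- by rewrite uv u'v adj_irrefl in uu'.
- move=> _; apply/eqP => e; have := fi u'; rewrite !inE e eqxx => /(_ isT).
  by rewrite -uv uu'.
- move=> _; apply/eqP => e; have := fi u; rewrite !inE e eqxx => /(_ isT).
  by rewrite -u'v adj_sym uu'.
- exact: cp.
Qed.

Lemma proper_of_partial c : partial_proper c -> color_class c 0 = finset.set0 ->
  proper_coloring G D.+1 c.
Proof.
move=> [cD cp] c0; have cn u : c u != 0%N.
  by have := finset.in_set0 u; rewrite -c0 inE => ->.
apply/andP; split; first by apply/forallP => u; rewrite lt0n cn cD.
by apply/forallP => u; apply/forallP => v; apply/implyP => /cp; apply.
Qed.

End PartialColorings.

(* In a random order the number of neighbours of [u] still uncoloured at its turn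
   is uniform; the first hypothesis is the recurrence for averages of [phi]. *)
Lemma potential_step (R : realType) n (G : graph n) D (U : {set 'I_n})
    (phi Psi : nat -> R) :
  (forall y, phi y + y%:R * Psi y.-1 <= y.+1%:R * Psi y) ->
  (forall y, Psi y.+1 <= Psi y) ->
  \sum_(v in U) (phi (slack G D U v) + \sum_(u in U :\ v) Psi (slack G D (U :\ v) u))
    <= #|U|%:R * \sum_(u in U) Psi (slack G D U u).
Proof.
move=> rec mono; rewrite big_split /= [X in _ + X](exchange_big_dep (mem U)) /=;
  last first.
  by move=> v u _; rewrite inE => /andP[].
rewrite -big_split mulr_sumr; apply: ler_sum => u uU /=.
set y := slack G D U u; set x := #|[set v in U | adj G u v]|.
have xy : (x <= y)%N by rewrite leq_addl.
have monoP : Psi y <= Psi y.-1 by case: y {xy} => //.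
(* Choosing [v] lowers the slack of [u] by one exactly when they are adjacent, which happens for [x]
   choices. *)
have sumE : \sum_(v in U | u \in U :\ v) Psi (slack G D (U :\ v) u) =
    x%:R * Psi y.-1 + (#|U|%:R - 1 - x%:R) * Psi y.
  have adj_sum : \sum_(v in U :\ u) (adj G u v)%:R = x%:R :> R.
    rewrite -[RHS]sumr_const big_mkcond [RHS]big_mkcond; apply: eq_bigr => v _ /=.
    by rewrite !inE; case: (v =P u) => [->|_]; rewrite ?adj_irrefl ?andbF //;
      case: (v \in U); case: (adj G u v).
  rewrite (eq_bigl (mem (U :\ u))) => [|v]; last first.
    by rewrite !inE uU andbT andbC eq_sym.
  rewrite (eq_bigr (fun v => Psi y + (adj G u v)%:R * (Psi y.-1 - Psi y)));
    last first.
    move=> v; rewrite !inE => /andP[vu vU].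
    have -> : slack G D (U :\ v) u = (y - adj G u v)%N.
      rewrite /y /slack (cardsD1 v [set v0 in U | adj G u v0]) !inE vU /=.
      rewrite [[set v0 in U | adj G u v0] :\ v](_ :
        _ = [set v0 in U :\ v | adj G u v0]).
        by case: (adj G u v) => /=; rewrite ?subn0 // addnCA add1n subn1.
      by apply/setP => t; rewrite !inE andbA.
    by case: (adj G u v) => /=; rewrite ?subn0 ?subn1; ring.
  rewrite big_split /= sumr_const -mulr_suml adj_sum.
  by rewrite (cardsD1 u U) uU natrD /= -[_ *+ #|_|]mulr_natr; ring.
rewrite sumE.
have := rec y; rewrite -natr1.
(* As [Psi] decreases, [x] may be raised to [y], where the recurrence applies. *)
have : x%:R <= y%:R :> R by rewrite ler_nat.
nra.
Qed.

Section Coloring.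
Variables (R : realType) (n m : nat) (G : graph n) (w : R).
Variable h : {ffun 'I_n -> nat} -> R.
Hypothesis w0 : 0 <= w.
Local Notation prog := (qprog R n m).
Local Notation bounded := (bounded G w h).
Implicit Types (c : {ffun 'I_n -> nat}).
Variables D L : nat.

(** When the attempts run out, colour 1 is assigned blindly; [trial_error] accounts for this. *)
Fixpoint trial t c v (next : {ffun 'I_n -> nat} -> prog) : prog :=
  if t is t'.+1 then
    Random (fun i : 'I_D.+1 => search v (color_class c i.+1) L
      (fun found => if found then trial t' c v next else next (recolor c v i.+1)))
  else next (recolor c v 1).

Definition class_rounds c (i : 'I_D.+1) : R := (rounds R (color_class c i.+1))%:R.

(** With K colours, f of them free, an attempt costs 1/K of the numerator on average and K / f
    attempts are expected; K cancels. *)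
Definition trial_cost c v : R :=
  (L%:R * \sum_(i | free_color G c v i) class_rounds c i + 4 * \sum_i class_rounds c
    i) /
  #|[set i : 'I_D.+1 | free_color G c v i]|%:R.

Lemma trial_cost_ge0 c v : 0 <= trial_cost c v.
Proof.
by rewrite divr_ge0 // addr_ge0 // mulr_ge0 //; apply: sumr_ge0.
Qed.

(** The first term is for neighbours missed in at most K expected attempts, the second for [t] draws
    without a free colour. *)
Definition trial_error t : R := D.+1%:R * (3 / 4) ^+ L + (1 - D.+1%:R^-1) ^+ t.

(** [V] bounds what follows a free colour and [E] is the surcharge after any other. The bound solves
    the recurrence of a geometric waiting time. *)
Lemma bounded_trial t c v next V E : c v = 0%N -> 0 <= E ->
  (0 < #|[set i : 'I_D.+1 | free_color G c v i]|)%N ->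
  (forall i : 'I_D.+1, free_color G c v i -> bounded (next (recolor c v i.+1)) V) ->
  (forall i : 'I_D.+1, bounded (next (recolor c v i.+1)) (V + E)) ->
  bounded (trial t c v next) (V + w * trial_cost c v + trial_error t * E).
Proof.
move=> cv E0 F0 bV bE; set F := [set i | _] in F0.
have FR : 1 <= #|F|%:R :> R by rewrite ler1n.
have FK : #|F|%:R <= D.+1%:R :> R by rewrite ler_nat; have := max_card (mem F);
  rewrite card_ord.
have cost0 : 0 <= w * trial_cost c v by rewrite mulr_ge0 // trial_cost_ge0.
have eps0 : 0 <= (3 / 4) ^+ L :> R by rewrite exprn_ge0 //; lra.
set K := D.+1%:R : R.
have K1 : 1 <= K by rewrite /K ler1n.
have rho0 : 0 <= 1 - K^-1 by rewrite subr_ge0 invf_le1 //; lra.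
elim: t => [|t IH] /=.
  apply: bounded_le (bE ord0) _; rewrite /trial_error expr0 -/K.
  have : 0 <= K * (3 / 4) ^+ L * E by rewrite !mulr_ge0 //; lra.
  nra.
set Y := _ + _ in IH.
have YV : V <= Y.
  rewrite /Y -addrA lerDl addr_ge0 // mulr_ge0 // /trial_error addr_ge0 //.
  exact: exprn_ge0.
(* Free colours are charged the 4 as well, so that the second sum runs over all colours. *)
pose B i := w * ((if free_color G c v i then L%:R * class_rounds c i else 0) + 4 *
  class_rounds c i)
  + (if free_color G c v i then V else Y + (3 / 4) ^+ L * E).
apply: bounded_le (bounded_random (B := B) _) _.
  move=> i; pose k found := if found then trial t c v next else next (recolor c v
    i.+1).
  rewrite /B; case: ifP => fi.
    apply: bounded_le (bounded_search_unmarked (k := k) w0 L _ IH (bV i fi)) _.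
      exact: (forall_inP fi).
    rewrite lerD2r mulrCA mulrDr lerDl !mulr_ge0 //.
  apply: bounded_le (bounded_search_marked (k := k) w0 L _ _ E0 _ IH (bE i)) _.
  - by rewrite inE cv.
  - by move/negbT: fi; rewrite /free_color negb_forall_in => /exists_inP[u cu];
    rewrite negbK; exists u.
  - by rewrite lerD2r.
  - by rewrite add0r /class_rounds -addrA mulrCA.
rewrite /B /= big_split /= -mulr_sumr big_split /= -mulr_sumr -big_mkcond /=
  -mulr_sumr.
have -> : \sum_(i < D.+1) (if free_color G c v i then V else Y + (3 / 4) ^+ L * E) =
    #|F|%:R * V + (K - #|F|%:R) * (Y + (3 / 4) ^+ L * E).
  rewrite (bigID (free_color G c v)) /= (eq_bigr (fun=> V)) => [|i ->//].
  rewrite [X in _ + X](eq_bigr (fun=> Y + (3 / 4) ^+ L * E)) => [|i /negPf->//].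
  have -> : K - #|F|%:R = #|~: F|%:R.
    have -> : K = #|F|%:R + #|~: F|%:R by rewrite -natrD cardsC card_ord.
    by rewrite addrC addKr.
  rewrite !sumr_const -[X in X + _]mulr_natl -[X in _ + X]mulr_natl.
  by congr (_%:R * _ + _%:R * _); apply: eq_card => i; rewrite !inE.
set A := _ + 4 * _.
have AE : A = trial_cost c v * #|F|%:R by rewrite divfK // lt0r_neq0 //; lra.
rewrite ler_pdivrMl ?ltr0n // -/K AE /Y /trial_error exprS -/K.
have KK : K * (1 - K^-1) = K - 1 by rewrite mulrBr mulr1 divff // lt0r_neq0 //; lra.
move: cost0 eps0 FR FK; rewrite -/K.
have := exprn_ge0 t rho0.
move: ((3 / 4) ^+ L) ((1 - K^-1) ^+ t) (trial_cost c v) (#|F|%:R : R) => eps rho C f.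
move=> rt cost0 eps0 FR FK.
have -> : K * (V + w * C + (K * eps + (1 - K^-1) * rho) * E) =
  K * V + K * (w * C) + (K * K * eps + (K - 1) * rho) * E by rewrite -KK; ring.
have h1 : (K - f) * rho * E <= (K - 1) * rho * E.
  by rewrite !ler_wpM2r //; lra.
(* One more attempt may miss once more; (K - 1) * (K + 1) <= K * K absorbs it, as f is at least
   1. *)
have h2 : (K - f) * ((K + 1) * (eps * E)) <= (K - 1) * ((K + 1) * (eps * E)).
  by rewrite ler_wpM2r ?mulr_ge0 //; lra.
have h3 : 0 <= eps * E by rewrite mulr_ge0.
lra.
Qed.

End Coloring.

(** * The greedy algorithm *)

Section CostPotential.
Variable R : realType.
Implicit Types (al be : R) (y : nat).

Definition harmonic_sum y : R := \sum_(i < y) i.+1%:R^-1.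

Definition step_cost al be y : R := al / Num.sqrt y.+1%:R + be / y.+1%:R.

(** A bound on the average of [step_cost] over 0, ..., y: the sum of the first y + 1 inverse square
    roots is at most 2 sqrt (y + 1), and that of the inverses is harmonic. *)
Definition potential al be y : R :=
  2 * al / Num.sqrt y.+1%:R + be * harmonic_sum y.+1 / y.+1%:R.

Lemma harmonic_sumS y : harmonic_sum y.+1 = harmonic_sum y + y.+1%:R^-1.
Proof. by rewrite /harmonic_sum big_ord_recr. Qed.

(** This is what makes the averages [harmonic_sum y.+1 / y.+1%:R] decrease. *)
Lemma harmonic_sum_ge y : y%:R / y.+1%:R <= harmonic_sum y.
Proof.
elim: y => [|y IH]; first by rewrite /harmonic_sum big_ord0 mul0r.
rewrite harmonic_sumS.
have y1 : 0 < y.+1%:R :> R by []. have y2 : 0 < y.+2%:R :> R by [].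
apply: le_trans (lerD IH (lexx _)).
rewrite -[X in _ + X]mul1r -mulrDl natr1 divff ?lt0r_neq0 //.
by rewrite ler_pdivrMr // mul1r ler_nat.
Qed.

Lemma harmonic_sum_le_ln y : harmonic_sum y.+1 <= 1 + ln y.+1%:R.
Proof.
elim: y => [|y IH]; first by rewrite harmonic_sumS /harmonic_sum big_ord0 ln1 add0r
  addr0 invr1.
rewrite harmonic_sumS; set x := y.+1%:R : R.
have x0 : 0 < x by []. have x1 : 0 < x + 1 by lra.
have xE : y.+2%:R = x + 1 by rewrite natr1.
(* ln (1 - t) <= - t at t = 1 / (x + 1) gives 1 / (x + 1) <= ln (x + 1) - ln x. *)
have := @le_ln1Dx R (- (x + 1)^-1); rewrite ltrN2 invf_lt1 // ltrDr x0 => /(_ isT).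
have -> : 1 - (x + 1)^-1 = x / (x + 1) by field; lra.
rewrite ln_div ?posrE // xE; move: IH; rewrite -/x; lra.
Qed.

Lemma sqrt_step y : (Num.sqrt y.+1%:R)^-1 + 2 * Num.sqrt y%:R <=
  2 * Num.sqrt y.+1%:R :> R.
Proof.
set a := Num.sqrt _; set b := Num.sqrt y%:R.
have a0 : 0 < a by rewrite sqrtr_gt0.
have b0 : 0 <= b by rewrite sqrtr_ge0.
have aa : a ^+ 2 = b ^+ 2 + 1 by rewrite !sqr_sqrtr // natr1.
rewrite -lerBrDr -[leLHS]div1r ler_pdivrMr //.
(* As a^2 - b^2 = 1, the claim amounts to (a - b)^2 >= 0. *)
nra.
Qed.

Lemma divr_sqrt (x : R) : 0 <= x -> x / Num.sqrt x = Num.sqrt x.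
Proof.
move=> x0; have [->|xn] := eqVneq x 0; first by rewrite sqrtr0 mul0r.
by rewrite -{1}(sqr_sqrtr x0) expr2 mulfK // sqrtr_eq0 -ltNge lt0r xn.
Qed.

Lemma potential_rec al be y : 0 <= al -> 0 <= be ->
  step_cost al be y + y%:R * potential al be y.-1 <= y.+1%:R * potential al be y.
Proof.
move=> al0 be0.
have -> : y.+1%:R * potential al be y = 2 * al * Num.sqrt y.+1%:R + be * harmonic_sum
  y.+1.
  rewrite /potential mulrDr; congr (_ + _); last by rewrite mulrC divfK.
  by rewrite mulrCA divr_sqrt.
have -> : y%:R * potential al be y.-1 = 2 * al * Num.sqrt y%:R + be * harmonic_sum y.
  case: y => [|y] /=; first by rewrite mul0r sqrtr0 /harmonic_sum big_ord0 !mulr0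
    addr0.
  rewrite /potential mulrDr; congr (_ + _); last by rewrite mulrC divfK.
  by rewrite mulrCA divr_sqrt.
rewrite /step_cost harmonic_sumS mulrDr.
have arith (i a b H j : R) : al * (i + 2 * a) <= al * (2 * b) ->
    al * i + be * j + (2 * al * a + be * H) <= 2 * al * b + (be * H + be * j).
  by lra.
exact: arith (ler_wpM2l al0 (sqrt_step y)).
Qed.

Lemma potential_decr al be y : 0 <= al -> 0 <= be ->
  potential al be y.+1 <= potential al be y.
Proof.
move=> al0 be0; apply: lerD.
  rewrite ler_wpM2l ?mulr_ge0 // lef_pV2 ?posrE ?sqrtr_gt0 //.
  by rewrite ler_sqrt // ler_nat.
rewrite -!mulrA ler_wpM2l // harmonic_sumS.
have := harmonic_sum_ge y.+1; move: (harmonic_sum _) => H.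
have y1 : 0 < y.+1%:R :> R by []. have y2 : 0 < y.+2%:R :> R by [].
move=> Hge; rewrite ler_pdivrMr // mulrAC ler_pdivlMr // mulrDl [_^-1 * _]mulrC.
by rewrite -[y.+2%:R in leRHS]natr1 mulrDr mulr1 lerD2l.
Qed.

Lemma potential_ge0 al be y : 0 <= al -> 0 <= be -> 0 <= potential al be y.
Proof.
move=> al0 be0; rewrite addr_ge0 ?divr_ge0 ?mulr_ge0 ?sqrtr_ge0 //.
by apply: sumr_ge0.
Qed.

End CostPotential.

(** The classes are disjoint, so by Cauchy-Schwarz the square roots of their sizes sum to at most
    sqrt (n |P|). Rounding up adds |P|, which is no larger since |P| <= n. *)
Lemma sum_class_rounds (R : realType) n (c : {ffun 'I_n -> nat}) D (P :
  pred 'I_D.+1) :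
  (0 < #|P|)%N -> (#|P| <= n)%N ->
  \sum_(i | P i) class_rounds R c i <= 2 * Num.sqrt (n%:R * #|P|%:R).
Proof.
move=> P0 Pn.
have PR : 0 < #|P|%:R :> R by rewrite ltr0n.
have PnR : #|P|%:R <= n%:R :> R by rewrite ler_nat.
have nR : 0 < n%:R :> R by lra.
set q := Num.sqrt _.
have q0 : 0 < q by rewrite sqrtr_gt0 mulr_gt0.
have qq : q ^+ 2 = n%:R * #|P|%:R by rewrite sqr_sqrtr // mulr_ge0.
have classes : \sum_(i | P i) #|color_class c i.+1|%:R <= n%:R :> R.
  rewrite -natr_sum ler_nat.
  under eq_bigr do rewrite -sum1_card big_mkcond.
  rewrite exchange_big /= -[leqRHS]card_ord -sum1_card; apply: leq_sum => u _.
  rewrite -big_mkcondr /=; case: (pickP (fun i : 'I_D.+1 => P i && (c u == i.+1))) =>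
    [i0|none].
    move=> /andP[Pi0 /eqP cu]; rewrite sum1_card; apply/card_le1_eqP => i j.
    move=> /andP[_]; rewrite inE cu => /eqP[ei] /andP[_]; rewrite inE cu => /eqP[ej].
    by apply: val_inj; rewrite /= -ei -ej.
  by rewrite big1 // => i; rewrite inE none.
pose s (i : 'I_D.+1) := #|color_class c i.+1|%:R : R.
have sqrt_sum : \sum_(i | P i) Num.sqrt (s i) <= q.
  rewrite -(ler_pM2l q0) -expr2 qq mulr_sumr.
  have sumE : \sum_(i | P i) 2^-1 * (#|P|%:R * s i + n%:R) =
      2^-1 * (#|P|%:R * \sum_(i | P i) s i + n%:R * #|P|%:R).
    by rewrite -mulr_sumr big_split -mulr_sumr sumr_const /= -[n%:R *+ _]mulr_natr.
  (* Cauchy-Schwarz in the form of the arithmetic-geometric mean inequality, term by term. *)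
  apply: le_trans (_ : \sum_(i | P i) 2^-1 * (#|P|%:R * s i + n%:R) <= _).
    apply: ler_sum => i _.
    have si : 0 <= s i by [].
    rewrite /q sqrtrM //.
    have arith (x y z : R) : z * x * y <= 2^-1 * (x ^+ 2 * y ^+ 2 + z ^+ 2).
      by have := sqr_ge0 (x * y - z); lra.
    by have := arith (Num.sqrt #|P|%:R) (Num.sqrt (s i)) (Num.sqrt n%:R);
      rewrite !sqr_sqrtr.
  rewrite sumE; have := ler_wpM2l (ltW PR) classes; rewrite -/s.
  rewrite (_ : \sum_(i | P i) _ = \sum_(i | P i) s i) //; nra.
have roundsE i : class_rounds R c i <= Num.sqrt (s i) + 1.
  by rewrite /class_rounds /rounds -natr1 lerD2r truncn_le sqrtr_ge0.
apply: le_trans (ler_sum _ (fun i _ => roundsE i)) _.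
rewrite big_split /=.
have : #|P|%:R <= q.
  have Pp := ltW PR.
  by rewrite -(ler_pXn2r (n := 2)) ?nnegrE ?(ltW q0) // qq expr2 ler_wpM2r.
have -> : \sum_(i | P i) (1 : R) = #|P|%:R by rewrite sumr_const.
lra.
Qed.

(** [sum_class_rounds] is applied to the free colours for the factor [L] and to all colours for the
    factor 4. *)
Lemma trial_cost_le (R : realType) n (G : graph n) D L c v y :
  (D < n)%N -> (y < #|[set i : 'I_D.+1 | free_color G c v i]|)%N ->
  trial_cost R G D L c v <=
    step_cost (2 * L%:R * Num.sqrt n%:R) (8 * Num.sqrt (n%:R * D.+1%:R)) y.
Proof.
move=> Dn yF; set F := [set i | _] in yF *.
have F0 : (0 < #|F|)%N by apply: leq_trans yF.
have FK : (#|F| <= D.+1)%N by have := max_card (mem F); rewrite card_ord.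
have FR : 0 < #|F|%:R :> R by rewrite ltr0n.
have sumF : \sum_(i < D.+1 | free_color G c v i) class_rounds R c i <=
  2 * Num.sqrt (n%:R * #|F|%:R).
  have FE : #|F| = #|(free_color G c v : pred 'I_D.+1)| by rewrite cardsE.
  by rewrite FE; apply: sum_class_rounds; rewrite -FE //; exact: leq_trans FK Dn.
have sumA : \sum_(i < D.+1) class_rounds R c i <= 2 * Num.sqrt (n%:R * D.+1%:R).
  by have := @sum_class_rounds R n c D xpredT; rewrite card_ord; apply.
apply: le_trans (_ : step_cost (2 * L%:R * Num.sqrt n%:R) (8 * Num.sqrt (n%:R *
  D.+1%:R)) #|F|.-1 <= _).
  rewrite /trial_cost /step_cost prednK // mulrDl; apply: lerD.
    rewrite -[X in _ / X](sqr_sqrtr (ltW FR)) expr2 invfM mulrA ler_pM2r ?invr_gt0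
      ?sqrtr_gt0 //.
    rewrite ler_pdivrMr ?sqrtr_gt0 // -[leRHS]mulrA -sqrtrM // -mulrA mulrCA.
    by rewrite ler_wpM2l.
  rewrite ler_pM2r ?invr_gt0 //; lra.
have FyR : y.+1%:R <= #|F|%:R :> R by rewrite ler_nat.
rewrite /step_cost prednK //; apply: lerD.
  rewrite ler_wpM2l ?mulr_ge0 ?sqrtr_ge0 // lef_pV2 ?posrE ?sqrtr_gt0 // ler_sqrt //.
by rewrite ler_wpM2l ?mulr_ge0 ?sqrtr_ge0 // lef_pV2 ?posrE.
Qed.

(** * Query and failure bounds for the greedy program *)

Section Greedy.
Variables (R : realType) (n m : nat) (G : graph n).
Local Notation prog := (qprog R n m).
Implicit Types (c : {ffun 'I_n -> nat}) (v : 'I_n) (U : {set 'I_n}).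

Lemma bounded_uniform (w : R) h U v0 s (f : 'I_n -> prog) B : 0 <= w ->
  enum U = v0 :: s -> (forall v, v \in U -> bounded G w h (f v) (B v)) ->
  bounded G w h (Random (fun j : 'I_(size s).+1 => f (nth v0 (v0 :: s) j)))
    (#|U|%:R^-1 * \sum_(v in U) B v).
Proof.
move=> w0 enumU b.
have -> : #|U|%:R^-1 * \sum_(v in U) B v =
    (size s).+1%:R^-1 * \sum_(j < (size s).+1) B (nth v0 (v0 :: s) j).
  by rewrite cardE -big_enum /= enumU (big_nth v0) big_mkord.
apply: bounded_random => // j; apply: b.
by rewrite -mem_enum enumU mem_nth.
Qed.

Fixpoint color_greedily (D L t k : nat) c : prog :=
  if k is k'.+1 then
    if enum (color_class c 0) is v0 :: s then
      Random (fun j : 'I_(size s).+1 =>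
        trial D L t c (nth v0 (v0 :: s) j) (color_greedily D L t k'))
    else Return R m c
  else Return R m c.

(** The slack depends only on the uncoloured set, so a wrong colour does not affect this bound:
    [bounded_trial] is used with surcharge 0, and [potential_step] averages over the chosen
    vertex. *)
Lemma bounded_greedy_queries D L t k c : (D < n)%N -> (forall v, (degree G v <=
  D)%N) ->
  let U := color_class c 0 in
  bounded G 1 (fun=> 0) (color_greedily D L t k c)
    (\sum_(u in U) potential (2 * L%:R * Num.sqrt n%:R) (8 * Num.sqrt (n%:R *
      D.+1%:R))
       (slack G D U u)).
Proof.
move=> Dn degD; set al := 2 * _ * _; set be := 8 * _.
have al0 : 0 <= al by rewrite !mulr_ge0 ?sqrtr_ge0.
have be0 : 0 <= be by rewrite mulr_ge0 ?sqrtr_ge0.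
have w0 : 0 <= 1 :> R by [].
have ret c' : bounded G 1 (fun=> 0) (Return R m c')
    (\sum_(u in color_class c' 0) potential al be (slack G D (color_class c' 0) u)).
  by apply: bounded_return; apply: sumr_ge0 => u _; apply: potential_ge0.
elim: k c => [|k IH] c /=; first exact: ret.
case enumU : (enum _) => [|v0 s]; first exact: ret.
set U := color_class c 0 in enumU *.
have U0 : 0 < #|U|%:R :> R by rewrite cardE enumU.
have step v : v \in U ->
    bounded G 1 (fun=> 0) (trial D L t c v (color_greedily D L t k))
      (step_cost al be (slack G D U v)
       + \sum_(u in U :\ v) potential al be (slack G D (U :\ v) u)).
  rewrite inE => /eqP cv.
  have next j : bounded G 1 (fun=> 0) (color_greedily D L t k (recolor c v j.+1))
      (\sum_(u in U :\ v) potential al be (slack G D (U :\ v) u) + 0).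
    by have := IH (recolor c v j.+1); rewrite addr0 color_class_recolor0.
  have F := slack_card_free degD c v.
  have next' (i : 'I_D.+1) : free_color G c v i ->
      bounded G 1 (fun=> 0) (color_greedily D L t k (recolor c v i.+1))
      (\sum_(u in U :\ v) potential al be (slack G D (U :\ v) u)).
    by move=> _; apply: bounded_le (next i) _; rewrite addr0.
  apply: bounded_le (bounded_trial w0 L t cv (lexx 0) (leq_ltn_trans (leq0n _) F)
    next' (fun i => next i)) _.
  by rewrite mulr0 addr0 mul1r addrC lerD2r; apply: trial_cost_le.
apply: bounded_le (bounded_uniform w0 enumU step) _.
rewrite ler_pdivrMl //; apply: potential_step => y.
- exact: potential_rec.
- exact: potential_decr.
Qed.

Lemma bounded_le1 h (p : prog) : (forall c, h c <= 1) -> bounded G 0 h p 1.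
Proof.
move=> h1; elim: p => [c|v k IH|r k IH|U Uu p IH|p IH|r f k IH] psi psi1.
- exact: (@bounded_return _ _ _ _ _ h).
- exact: IH.
- apply: bounded_at_le (bounded_at_random (B := fun=> 1) _) _ => // [i|];
  first exact: IH.
  by rewrite sumr_const card_ord mulVf // lt0r_neq0.
- by apply: IH; rewrite sqnorm_unitary.
- by move=> q /=; have := IH _ _ q.+1; rewrite !mul0r; apply; rewrite sqnorm_oracle.
- by apply: bounded_at_measure_const => // j phi phi0; apply: IH;
  apply: sqnorm_normalize.
Qed.

Definition improper D c : R := (~~ proper_coloring G D.+1 c)%:R.

(** A union bound over the vertices: after a wrong colour, failure is charged with probability 1, so
    each vertex adds one [trial_error]. *)
Lemma bounded_greedy_failure D L t k c : (forall v, (degree G v <= D)%N) ->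
  partial_proper G D c -> (#|color_class c 0| <= k)%N ->
  bounded G 0 (improper D) (color_greedily D L t k c) (k%:R * trial_error R D L t).
Proof.
move=> degD.
have err0 : 0 <= trial_error R D L t.
  apply: addr_ge0; first by rewrite mulr_ge0 // exprn_ge0 // divr_ge0.
  by apply: exprn_ge0; rewrite subr_ge0 invf_le1 // ler1n.
have ret c' (k' : nat) : partial_proper G D c' -> enum (color_class c' 0) = [::] ->
    bounded G 0 (improper D) (Return R m c') (k'%:R * trial_error R D L t).
  move=> cp U0; apply: bounded_return.
  rewrite /improper (proper_of_partial cp) ?mulr_ge0 //.
  by apply/eqP; rewrite -cards_eq0 cardE U0.
elim: k c => [|k IH] c cp Uk /=.
  by apply: ret => //; apply/eqP; rewrite -size_eq0 -cardE -leqn0.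
case enumU : (enum _) => [|v0 s]; first exact: (ret _ k.+1).
set U := color_class c 0 in enumU Uk.
have U0 : 0 < #|U|%:R :> R by rewrite cardE enumU.
suff step v : v \in U ->
    bounded G 0 (improper D) (trial D L t c v (color_greedily D L t k))
      (k.+1%:R * trial_error R D L t).
  apply: bounded_le (bounded_uniform (lexx 0) enumU step) _.
  by rewrite sumr_const -[X in _ * X]mulr_natl mulKf // lt0r_neq0.
move=> vU; have cv : c v = 0%N by move: vU; rewrite inE => /eqP.
have F := slack_card_free degD c v.
have next_free (i : 'I_D.+1) : free_color G c v i ->
    bounded G 0 (improper D) (color_greedily D L t k (recolor c v i.+1))
      (k%:R * trial_error R D L t).
  move=> fi; apply: IH; first exact: partial_proper_recolor.
  by move: Uk; rewrite color_class_recolor0 // /U (cardsD1 v) vU.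
have next_any (i : 'I_D.+1) : 
    bounded G 0 (improper D) (color_greedily D L t k (recolor c v i.+1))
      (k%:R * trial_error R D L t + 1).
  apply: bounded_le (bounded_le1 _ _) _ => [c'|]; last by rewrite lerDr mulr_ge0.
  by rewrite /improper; case: (proper_coloring _ _ _).
apply: bounded_le (bounded_trial (lexx 0) L t cv ler01 (leq_ltn_trans (leq0n _) F)
  next_free next_any) _.
by rewrite mul0r addr0 mulr1 -natr1 mulrDl mul1r.
Qed.

Fixpoint read_max_degree (vs : seq 'I_n) (D : nat) (k : nat -> prog) : prog :=
  if vs is v :: vs' then Degree v (fun d => read_max_degree vs' (maxn D d) k) else k
    D.

Lemma expect_read_max_degree g vs D k psi q :
  expect_from G g (read_max_degree vs D k) psi q =
  expect_from G g (k (maxn D (\max_(v <- vs) degree G v))) psi q.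
Proof.
elim: vs D => [|v vs IH] D /=; first by rewrite big_nil maxn0.
by rewrite IH big_cons maxnA.
Qed.

End Greedy.

(** * Choice of the parameters and the final estimates *)

Definition coloring_algorithm (R : realType) (a n : nat) : qalgorithm R n :=
  (* Then 2^-e <= (n + 1)^-(a + 2); the two extra powers pay for the n vertices and for the factor D
     + 2 in [trial_error_le]. *)
  let e := ((a + 2) * up_log 2 n.+1)%N in
  @QAlgorithm R n 0 (read_max_degree (enum 'I_n) 0 (fun D =>
    (* Both error terms get powers of 1/2, as (3/4)^4 <= 1/2 and (1 - 1/K)^K <= exp (-1) <= 1/2. *)
    color_greedily R 0 D (4 * e) (D.+1 * e) n [ffun=> 0%N])).

Lemma expectation_coloring (R : realType) (a n : nat) (G : graph n) g :
  let e := ((a + 2) * up_log 2 n.+1)%N in let D := max_degree G in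
  Defs.expectation (coloring_algorithm R a n) G g =
  expect_from G g (color_greedily R 0 D (4 * e) (D.+1 * e) n [ffun=> 0%N])
    (init_state R n 0) 0.
Proof.
by rewrite /Defs.expectation /= expect_read_max_degree max0n big_enum.
Qed.

Lemma degree_le_max n (G : graph n) v : (degree G v <= max_degree G)%N.
Proof. exact: (leq_bigmax v). Qed.

Lemma max_degree_lt n (G : graph n) : (0 < n)%N -> (max_degree G < n)%N.
Proof.
case: n G => // n G _; rewrite ltnS; apply/bigmax_leqP => v _; rewrite -ltnS.
suff : (degree G v < #|[set: 'I_n.+1]|)%N by rewrite cardsT card_ord.
apply: proper_card; apply/fintype.properP; split; first by apply/fintype.subsetP.
by exists v; rewrite !inE ?adj_irrefl.
Qed.

Lemma trial_error_le (R : realType) (D e : nat) :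
  trial_error R D (4 * e) (D.+1 * e) <= D.+2%:R * 2^-1 ^+ e.
Proof.
rewrite /trial_error !exprM -[D.+2%:R]natr1 [leRHS]mulrDl mul1r.
set K := D.+1%:R : R.
have K0 : 0 < K by [].
have rho0 : 0 <= 1 - K^-1 by rewrite subr_ge0 invf_le1 // ler1n.
apply: lerD.
  rewrite ler_wpM2l //; rewrite lerXn2r ?nnegrE ?exprn_ge0 ?divr_ge0 ?invr_ge0 //;
    lra.
rewrite lerXn2r ?nnegrE ?exprn_ge0 ?invr_ge0 //.
have x1 : 1 - K^-1 <= expR (- K^-1) by exact: expR_ge1Dx.
apply: (@le_trans _ _ (expR (- K^-1) ^+ D.+1)).
  by rewrite lerXn2r ?nnegrE ?expR_ge0.
rewrite -expRM_natl mulrN divff ?lt0r_neq0 // expRN lef_pV2 ?posrE ?expR_gt0 //.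
by have := expR_ge1Dx (1 : R); lra.
Qed.

Lemma pow_up_log_ge (R : realType) (b n : nat) :
  2^-1 ^+ (b * up_log 2 n.+1) <= n.+1%:R ^- b :> R.
Proof.
rewrite exprVn lef_pV2 ?posrE ?exprn_gt0 // mulnC exprM.
rewrite lerXn2r ?nnegrE ?exprn_ge0 // -natrX ler_nat.
exact: up_logP.
Qed.

(** The rounded logarithm is at most 1 + log n in base 2, and the 1 is at most log n because n >=
    2. *)
Lemma up_log_le_ln (R : realType) n : (1 < n)%N ->
  (up_log 2 n.+1)%:R <= 2 / ln 2 * ln n%:R :> R.
Proof.
move=> n1; have n2 : 2 <= n%:R :> R by rewrite ler_nat.
have n0 : 0 < n%:R :> R by lra.
have ln2 : 0 < ln 2 :> R by rewrite ln_gt0 // ltr1n.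
have lnn : ln 2 <= ln n%:R :> R by rewrite ler_ln ?posrE //; lra.
set u := up_log _ _.
have u0 : (0 < u)%N by rewrite up_log_gt0 /= ltnS; apply: ltnW.
have : ln (2 ^+ u.-1) <= ln n%:R :> R.
  rewrite ler_ln ?posrE ?exprn_gt0 // -natrX ler_nat -ltnS.
  by apply: up_log_gtn => //; apply: ltnW.
rewrite lnXn // -[X in X <= _]mulr_natl => h.
rewrite mulrAC ler_pdivlMr // -(prednK u0) -natr1 mulrDl mul1r; lra.
Qed.

(** Here [a] sets the error exponent. In degree 0 the bound would read 0, since division by 0 yields
    0, yet the program still makes queries on a nonempty graph. *)
Theorem theorem2 (R : realType) (a : nat) :
  exists (A : forall n : nat, qalgorithm R n) (C : R),
    forall (n : nat) (G : graph n),
      1 - n.+1%:R ^- a <= success_probability (A n) G /\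
      ((0 < max_degree G)%N ->
        expected_queries (A n) G <=
          C * (n%:R `^ (3 / 2) * ln n%:R / Num.sqrt (max_degree G)%:R)).
Proof.
(* The first summand comes from [4 * L] through [LN], the second from 8 times the harmonic sum
   through [HN]. *)
exists (coloring_algorithm R a), (32 * (a + 2)%:R / ln 2 + 8 * (1 + (ln 2)^-1)) =>
  n G.
have degD := degree_le_max G.
split=> [|D0].
  rewrite /success_probability expectation_coloring.
  case: n G degD => [|n] G degD.
    (* Without vertices there is no unit state, but the bound to prove is 0. *)
    by rewrite expr1n invr1 subrr /=.
  set D := max_degree G; set p := color_greedily _ _ _ _ _ _ _.
  have -> : (fun c (_ : nat) => (proper_coloring G D.+1 c)%:R) =
      (fun c q => 1 - (0 * q%:R + improper R G D c)) :> ({ffun _ -> _} -> nat -> R).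
    by apply/funext => c; apply/funext => q; rewrite /improper mul0r add0r;
       case: proper_coloring; rewrite ?subr0 ?subrr.
  have init1 : sqnorm (init_state R n.+1 0) = 1 by exact: sqnorm_init_state.
  rewrite (expect_from_compl _ _ _ _ init1) lerD2l lerN2.
  have cp : partial_proper G D [ffun=> 0%N] by split=> [u|u v _]; rewrite !ffunE.
  have Un : (#|color_class ([ffun=> 0%N] : {ffun 'I_n.+1 -> nat}) 0| <= n.+1)%N.
    by apply: leq_trans (max_card _) _; rewrite card_ord.
  apply: le_trans (bounded_greedy_failure _ _ degD cp Un init1 0) _.
  rewrite mul0r add0r.
  apply: le_trans (ler_wpM2l _ (trial_error_le _ _ _)) _ => //.
  have Dn : D.+2%:R <= n.+2%:R :> R by rewrite ler_nat !ltnS -ltnS max_degree_lt.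
  apply: (@le_trans _ _ (n.+1%:R * (n.+2%:R * n.+2%:R ^- (a + 2)))).
    by rewrite ler_wpM2l // ler_pM ?exprn_ge0 ?invr_ge0 // pow_up_log_ge.
  have n2 : n.+2%:R != 0 :> R by [].
  rewrite -exprVn exprD exprVn; set x := _ ^- a.
  rewrite (_ : _ * _ = x * (n.+1%:R / n.+2%:R)); last by field.
  by rewrite ler_piMr ?invr_ge0 ?exprn_ge0 // ler_pdivrMr // mul1r ler_nat.
have n1 : (1 < n)%N.
  by case: n G degD D0 => [|n] G _ D0; [have := D0;
    rewrite /max_degree big_ord0 | apply: leq_ltn_trans D0 _; apply: max_degree_lt].
have Dn : (max_degree G < n)%N by apply: max_degree_lt; apply: ltnW.
rewrite /expected_queries expectation_coloring; set D := max_degree G in D0 Dn degD *.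
have -> : (fun (_ : {ffun 'I_n -> nat}) q => q%:R) = (fun _ q =>
  1 * q%:R + 0) :> (_ -> nat -> R).
  by apply/funext => c; apply/funext => q; rewrite mul1r addr0.
have init1 : sqnorm (init_state R n 0) = 1 by apply: sqnorm_init_state; apply: ltnW.
apply: le_trans (bounded_greedy_queries _ _ _ _ Dn degD init1 0) _.
rewrite mulr0 add0r.
set L := (4 * _)%N.
have -> : color_class [ffun=> 0%N] 0 = [set: 'I_n].
  by apply/setP => u; rewrite !inE ffunE.
(* Initially all neighbours are uncoloured, so every vertex has slack exactly [D]. *)
rewrite (eq_bigr (fun=> potential (2 * L%:R * Num.sqrt n%:R) (8 * Num.sqrt (n%:R *
  D.+1%:R)) D)); last first.
  move=> u _; congr potential; rewrite /slack (_ : #|_| = degree G u) ?subnK //.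
  by apply: eq_card => v; rewrite !inE.
rewrite sumr_const cardsT card_ord -[leLHS]mulr_natl.
set K := D.+1%:R : R; set N := n%:R : R; set s := Num.sqrt N; set d := Num.sqrt D%:R.
have N2 : 2 <= N by rewrite ler_nat.
have DR : 0 < D%:R :> R by rewrite ltr0n.
have d0 : 0 < d by rewrite sqrtr_gt0.
have s0 : 0 <= s by rewrite sqrtr_ge0.
have K0 : 0 < K by [].
have ln2 : 0 < ln 2 :> R by rewrite ln_gt0 // ltr1n.
have lnN : ln 2 <= ln N by rewrite ler_ln ?posrE //; lra.
have ln0 : 0 < ln N by lra.
have HN : harmonic_sum R D.+1 <= (1 + (ln 2)^-1) * ln N.
  apply: le_trans (harmonic_sum_le_ln _ _) _; rewrite mulrDl mul1r addrC lerD //.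
    by rewrite ler_ln ?posrE ?ler_nat //; lra.
  by rewrite mulrC ler_pdivlMr // mul1r.
have LN : L%:R <= 8 * (a + 2)%:R / ln 2 * ln N.
  rewrite /L !natrM.
  have := ler_wpM2l (ler0n R (4 * (a + 2))) (up_log_le_ln R n1); rewrite natrM -/N;
    lra.
have powN : N `^ (3 / 2) = N * s.
  rewrite (_ : 3 / 2 = 1 + 2^-1); last by lra.
  by rewrite powRD ?powRr1 ?powR12_sqrt //; try lra; apply/implyP => _; lra.
have -> : potential (2 * L%:R * s) (8 * Num.sqrt (N * K)) D =
    s / Num.sqrt K * (4 * L%:R + 8 * harmonic_sum R D.+1).
  have rK : Num.sqrt K / K = (Num.sqrt K)^-1.
    by rewrite -{2}(sqr_sqrtr (ltW K0)) expr2 invfM mulrA mulfV ?mul1r //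
      sqrtr_eq0 -ltNge.
  rewrite /potential -/K sqrtrM ?ler0n // -/s.
  rewrite [X in _ + X](_ : _ = 8 * s * harmonic_sum R D.+1 * (Num.sqrt K / K));
    last by ring.
  by rewrite rK; ring.
have dK : s / Num.sqrt K <= s / d.
  by rewrite ler_wpM2l // lef_pV2 ?posrE ?sqrtr_gt0 // ler_sqrt // ler_nat.
rewrite powN.
have -> : (32 * (a + 2)%:R / ln 2 + 8 * (1 + (ln 2)^-1)) * (N * s * ln N / d) =
   N * (s / d * ((32 * (a + 2)%:R / ln 2 + 8 * (1 + (ln 2)^-1)) * ln N)) by ring.
rewrite ler_wpM2l //.
apply: ler_pM => //; first by rewrite divr_ge0 ?sqrtr_ge0.
  by rewrite addr_ge0 // mulr_ge0 //; apply: sumr_ge0.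
move: LN HN; lra.
Qed.
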